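(* For every integer $t\geq 3$ we have $\xi(K_{1,t})=\left\lfloor\frac{3t-1}{2}\right\rfloor$ and $2t-1\leq f(K_{1,t})\leq 2t$.
   Context: $K_{1,t}$ is the star with $t$ edges. For a graph $H$, $\xi(H)$ is the largest integer $n$ such that there is an edge coloring of the complete graph $K_n$ with three colors in which every subgraph isomorphic to $H$ contains edges of all three colors (this holds vacuously if $K_n$ contains no copy of $H$). The online Ramsey turnaround game for a graph $H$ on $n$ vertices, with colors red, green, blue, is played by Builder and Painter. In each round Builder exposes one new (previously unexposed) edge on a fixed set of $n$ vertices and may forbid one of the three colors for this edge; Painter then immediately colors this edge with a color that is not forbidden. Painter wins as soon as there is a monochromatic copy of $H$; Builder wins if all $\binom n2$ edges have been exposed without a monochromatic copy of $H$. $f(H)$ is the smallest $n$ such that Painter has a winning strategy in this game for $H$ on $n$ vertices. *)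

(* Defs.v *)
From mathcomp Require Import all_boot.

Set Implicit Arguments.
Unset Strict Implicit.
Unset Printing Implicit Defensive.

Record sgraph := SGraph {
  vertex : finType;
  adj : rel vertex;
  adj_sym : symmetric adj;
  adj_irr : irreflexive adj }.

(* None is the centre of the star, the Some i are its leaves. *)
Definition star_adj (t : nat) : rel (option 'I_t) :=
  fun x y => isSome x != isSome y.

Fact star_sym t : symmetric (@star_adj t).
Proof. by move=> x y; rewrite /star_adj eq_sym. Qed.

Fact star_irr t : irreflexive (@star_adj t).
Proof. by move=> x; rewrite /star_adj eqxx. Qed.

Definition star (t : nat) : sgraph := SGraph (@star_sym t) (@star_irr t).

Definition color := 'I_3.

Definition Kedge (n : nat) := {e : {set 'I_n} | #|e| == 2}.

(* The subgraphs of K_n isomorphic to H are the images of H under the injective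
   maps from its vertices to those of K_n; this is the edge set of the image. *)
Definition copy_edges (H : sgraph) (n : nat) (phi : vertex H -> 'I_n) :
    {set Kedge n} :=
  [set e | [exists x, exists y, adj x y && (val e == [set phi x; phi y])]].

Definition all_copies_three_colored (H : sgraph) (n : nat)
    (col : {ffun Kedge n -> color}) : Prop :=
  forall phi : vertex H -> 'I_n, injective phi ->
  forall c : color, exists2 e, e \in copy_edges phi & col e = c.

Definition xi_admissible (H : sgraph) (n : nat) : Prop :=
  exists col : {ffun Kedge n -> color}, all_copies_three_colored H col.

(* "xi(H) = n", as a relation: the maximum need not exist for every H. *)
Definition is_xi (H : sgraph) (n : nat) : Prop :=
  xi_admissible H n /\ forall m, xi_admissible H m -> m <= n.

(* Builder's move: the exposed edge, and the forbidden color, if any. *)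
Definition bmove (n : nat) : Type := Kedge n * option color.

Definition round (n : nat) : Type := bmove n * color.

Definition history (n : nat) := seq (round n).

Definition strategy (n : nat) := history n -> bmove n -> color.

Definition legal_strategy (n : nat) (sigma : strategy n) : Prop :=
  forall (h : history n) (b : bmove n), b.2 != Some (sigma h b).

(* Painter's strategy being deterministic, the possible behaviours of Builder,
   adaptive or not, amount to sequences of moves that expose each edge once. *)
Definition full_bmoves (n : nat) (bs : seq (bmove n)) : Prop :=
  uniq (map fst bs) /\ forall e : Kedge n, e \in map fst bs.

Fixpoint play_from (n : nat) (sigma : strategy n) (h : history n)
    (bs : seq (bmove n)) : history n :=
  if bs is b :: bs' then play_from sigma (rcons h (b, sigma h b)) bs' else h.

Definition play (n : nat) (sigma : strategy n) (bs : seq (bmove n)) :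
  history n := play_from sigma [::] bs.

Definition has_mono_copy (H : sgraph) (n : nat) (h : history n) : Prop :=
  exists phi : vertex H -> 'I_n, injective phi /\
  exists c : color, forall e, e \in copy_edges phi ->
    exists2 r, r \in h & r.1.1 = e /\ r.2 = c.

Definition winning_strategy (H : sgraph) (n : nat) (sigma : strategy n) : Prop :=
  legal_strategy sigma /\
  forall bs : seq (bmove n), full_bmoves bs ->
    exists k : nat, has_mono_copy H (play sigma (take k bs)).

Definition painter_wins (H : sgraph) (n : nat) : Prop :=
  exists sigma : strategy n, winning_strategy H sigma.

(* "f(H) = n", as a relation. *)
Definition is_f (H : sgraph) (n : nat) : Prop :=
  painter_wins H n /\ forall m, painter_wins H m -> n <= m.

(* Main.v *)
Require Import Defs.
From mathcomp Require Import all_boot zify.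
From Stdlib Require Import Classical.

Set Implicit Arguments.
Unset Strict Implicit.
Unset Printing Implicit Defensive.

(* A coloring of K_n is good for xi(K_{1,t}) iff each vertex has degree at least
   n - t in each color; summing over the colors, 3(n - t) <= n - 1. Colorings
   attaining this are built by adding six vertices at a time, which raises each
   color degree by two while t grows by four.

   On 2t vertices Painter wins by painting red whenever this is allowed and blue
   otherwise, by pigeonhole. On at most 2t - 2 vertices, Builder exposes
   successively the edges of each of the t - 1 zigzag Hamiltonian paths of
   K_{2t-2} (restricted to the board), each time forbidding the color of the
   previous edge of the path. The edges of one color at a vertex then lie on
   distinct paths, so there are at most t - 1 of them. *)

(** * Edges of K_n and embedded stars *)

(* Meaningful for symmetric f only; the default value f 0 0 is never reached. *)
Definition edge_lift (T : Type) (f : nat -> nat -> T) (n : nat)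
    (e : Kedge n) : T :=
  if enum (val e) is x :: y :: _ then f x y else f 0 0.

(** The enumeration of [val e] lists the two ends in an unknown order, which the symmetry of [f]
    makes irrelevant. *)
Lemma edge_liftE (T : Type) (f : nat -> nat -> T) (n : nat) (e : Kedge n) x y :
  (forall i j, f i j = f j i) -> val e = [set x; y] -> edge_lift f e = f x y.
Proof.
move=> fC exy; rewrite /edge_lift.
have xy : x != y by have := valP e; rewrite exy cards2; case: (x != y).
have: perm_eq (enum (val e)) [:: x; y].
  apply: uniq_perm => [||z]; rewrite ?enum_uniq //= ?inE ?andbT //.
  by rewrite mem_enum exy !inE.
move=> pm; have := perm_size pm.
case: (enum _) pm => [|u [|v []]] //= pm _.
have := perm_mem pm u; have := perm_mem pm v.
have := perm_uniq pm; rewrite /= !inE !eqxx !orbT !andbT xy.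
by move=> uv /esym /orP[] /eqP ev /esym /orP[] /eqP eu;
  move: uv; rewrite eu ev ?eqxx.
Qed.

Lemma exists_Kedge (n : nat) (x y : 'I_n) :
  x != y -> exists e : Kedge n, val e = [set x; y].
Proof.
move=> xy; have h : #|[set x; y]| == 2 by rewrite cards2 xy.
by exists (Sub [set x; y] h); rewrite SubK.
Qed.

Lemma mem_star_copy (t n : nat) (phi : vertex (star t) -> 'I_n) (e : Kedge n) :
  reflect (exists i, val e = [set phi None; phi (Some i)])
          (e \in copy_edges phi).
Proof.
rewrite inE; apply: (iffP existsP) => [[x /existsP[y /andP[]]]|[i ei]]; last first.
  by exists None; apply/existsP; exists (Some i); rewrite ei eqxx.
case: x y => [i|] [j|] //= _ /eqP ei; last by exists j.
by exists i; rewrite setUC.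
Qed.

Lemma star_embedding (t n : nat) (v : 'I_n) (A : {set 'I_n}) :
  v \notin A -> t <= #|A| ->
  exists phi : vertex (star t) -> 'I_n,
    [/\ injective phi, phi None = v & forall i, phi (Some i) \in A].
Proof.
move=> vA tA; pose leaf i := @enum_val _ (mem A) (widen_ord tA i).
have leafA i : leaf i \in A by exact: enum_valP.
exists (fun x => if x is Some i then leaf i else v); split=> // -[i|] [j|] //=.
- by move=> /enum_val_inj /(congr1 val) /= ij; congr Some; apply: val_inj.
- by move=> ev; case/negP: vA; rewrite -ev.
- by move=> ev; case/negP: vA; rewrite ev.
Qed.

Lemma card_star_leaves (t n : nat) (phi : vertex (star t) -> 'I_n)
    (A : {set 'I_n}) :
  injective phi -> (forall i, phi (Some i) \in A) -> t <= #|A|.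
Proof.
move=> phi_inj phiA; pose leaf i := phi (Some i).
have leaf_inj : injective leaf by move=> i j /phi_inj [].
rewrite -[t]card_ord -(card_imset _ leaf_inj); apply: subset_leq_card.
by apply/subsetP => _ /imsetP[i _ ->]; exact: phiA.
Qed.

(** * Decomposition of K_M, M even, into M/2 zigzag Hamiltonian paths *)

(* The zigzag path c, c+1, c-1, c+2, ... in Z/M consists of the edges ab with
   a + b = 2c or 2c + 1 mod M. *)
Definition path_index (M a b : nat) : nat :=
  (if a + b < M then a + b else a + b - M) %/ 2.
(* The position of the edge ab in its path. *)
Definition path_rank (M a b : nat) : nat :=
  if a + b < M then maxn a b - minn a b else M - (maxn a b - minn a b).

(** Mod 2T, the sums a + b and a + w are the two members of a pair 2c, 2c + 1, so w is b + 1 or b -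
    1. As 2T is even, the parity of a + b decides which. *)
Lemma path_index_next T a b w :
  a < T.*2 -> b < T.*2 -> w < T.*2 -> w != b ->
  path_index T.*2 a b = path_index T.*2 a w ->
  w = if odd (a + b) then if b == 0 then T.*2.-1 else b.-1
      else if b.+1 == T.*2 then 0 else b.+1.
Proof.
move=> ha hb hw wb.
have hp n : n = n %/ 2 * 2 + odd n by rewrite -modn2 -divn_eq.
rewrite /path_index; move: (hp (a + b)).
do 2![case: ltnP => ?]; case: odd => /=; do 2?case: eqP => ?; lia.
Qed.

Lemma path_rankC M a b : path_rank M a b = path_rank M b a.
Proof. by rewrite /path_rank addnC maxnC minnC. Qed.

Lemma path_indexC M a b : path_index M a b = path_index M b a.
Proof. by rewrite /path_index addnC. Qed.

Lemma path_rankE M a b : a <= b ->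
  path_rank M a b = if a + b < M then b - a else M - (b - a).
Proof. by move=> ab; rewrite /path_rank (maxn_idPr ab) (minn_idPl ab). Qed.

(** Ranks increase by one along a path, and aw and bx are the neighbors of ab on its two sides, so
    one of them has larger rank than ab. *)
Lemma path_rank_ends T a b w x :
  [/\ a < T.*2, b < T.*2, w < T.*2 & x < T.*2] ->
  [/\ a != b, w != a, w != b, x != a & x != b] ->
  path_index T.*2 a b = path_index T.*2 a w ->
  path_index T.*2 a b = path_index T.*2 b x ->
  path_rank T.*2 a w <= path_rank T.*2 a b ->
  path_rank T.*2 b x <= path_rank T.*2 a b -> False.
Proof.
wlog ab : a b w x / a < b.
  move=> IH hM hN; case: (ltngtP a b) (hN) => [|ba|->]; last by case.
    by move=> ab _; apply: IH ab hM hN.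
  case: hM hN => ha hb hw hx [ab wa wb xa xb] _ e1 e2 r1 r2.
  by apply: (IH b a x w ba); rewrite ?(path_rankC _ b a) ?(path_indexC _ b a)
     1?eq_sym.
case=> ha hb hw hx [_ wa wb xa xb] /(path_index_next ha hb hw wb) ew.
rewrite path_indexC => /(path_index_next hb ha hx xa); rewrite (addnC b a) => ex.
have es: a + b = odd (a + b) + (a + b)./2.*2 by rewrite odd_double_half.
rewrite (path_rankE _ (ltnW ab)) (path_rankC _ b).
move: ew ex es; case: (odd _) => /=.
  (* For a + b odd, w = b - 1 and x = a - 1 mod 2T; only x can wrap around, when a = 0. *)
  case: eqP => [eb|b0] ew; first by lia.
  have aw : a <= w by lia.
  case: eqP => a0 ex es.
    have xb' : b <= x by lia.
    by rewrite (path_rankC _ x)  !path_rankE //; do 3?[case: ltnP => ?]; lia.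
  have xb' : x <= b by lia.
  by rewrite !path_rankE //; do 3?[case: ltnP => ?]; lia.
(* For a + b even, w = b + 1 and x = a + 1 mod 2T; only w can wrap around, when b = 2T - 1. *)
case: eqP => [eb|b0] ew; case: eqP => [ea|a0] ex es; try lia.
  have [aw xb'] : w <= a /\ x <= b by lia.
  by rewrite (path_rankC _ a w) !path_rankE //; do 3?[case: ltnP => ?]; lia.
have [aw xb'] : a <= w /\ x <= b by lia.
by rewrite !path_rankE //; do 3?[case: ltnP => ?]; lia.
Qed.

(** * The game *)

Lemma play_from_cat (n : nat) (sigma : strategy n) (h : history n) bs1 bs2 :
  play_from sigma h (bs1 ++ bs2) = play_from sigma (play_from sigma h bs1) bs2.
Proof. by elim: bs1 h => //= b bs1 IH h; rewrite IH. Qed.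

Lemma play_rcons (n : nat) (sigma : strategy n) bs b :
  play sigma (rcons bs b) =
  rcons (play sigma bs) (b, sigma (play sigma bs) b).
Proof. by rewrite /play -cats1 play_from_cat. Qed.

Lemma play_moves (n : nat) (sigma : strategy n) bs :
  map fst (play sigma bs) = bs.
Proof.
by elim/last_ind: bs => // bs b IH; rewrite play_rcons map_rcons IH.
Qed.

Lemma sub_play_from (n : nat) (sigma : strategy n) (h : history n) bs :
  {subset h <= play_from sigma h bs}.
Proof.
elim: bs h => [|b bs IH] h r rh //=.
by apply: IH; rewrite mem_rcons inE rh orbT.
Qed.

(** A monochromatic copy present after [k] rounds persists, so Builder may argue about complete
    plays only. *)
Lemma sub_play_take (n : nat) (sigma : strategy n) bs k :
  {subset play sigma (take k bs) <= play sigma bs}.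
Proof.
by rewrite -{2}(cat_take_drop k bs) /play play_from_cat; exact: sub_play_from.
Qed.

Lemma uniq_map_inj_in (T1 T2 : eqType) (f : T1 -> T2) (s : seq T1) :
  uniq (map f s) -> {in s &, injective f}.
Proof.
elim: s => //= x s IH /andP[fx us] y z; rewrite !inE.
case/orP=> [/eqP->|ys] /orP[/eqP->|zs] // e; last exact: IH.
  by case/negP: fx; rewrite e map_f.
by case/negP: fx; rewrite -e map_f.
Qed.

(* Builder exposes the edges by increasing rank and forbids the color of the
   unique neighbor already exposed. *)
Lemma builder_separates (n : nat) (sigma : strategy n) (R : rel (Kedge n))
    (rank : Kedge n -> nat) (es : seq (Kedge n)) :
  legal_strategy sigma -> symmetric R -> irreflexive R ->
  (forall e e1 e2, rank e1 <= rank e -> rank e2 <= rank e ->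
     R e e1 -> R e e2 -> e1 = e2) ->
  uniq es -> pairwise (relpre rank leq) es ->
  exists2 bs : seq (bmove n), map fst bs = es &
    forall r r', r \in play sigma bs -> r' \in play sigma bs ->
      R r.1.1 r'.1.1 -> r.2 != r'.2.
Proof.
move=> legal symR irrR oneR; elim/last_ind: es => [|es e IH].
  by exists [::].
rewrite rcons_uniq pairwise_rcons => /andP[ees ues] /andP[/allP rank_e pw].
have [bs ebs sep] := IH ues pw.
pose h := play sigma bs.
have hes r : r \in h -> r.1.1 \in es.
  by move=> rh; rewrite -ebs -(play_moves sigma bs) -map_comp (map_f (fst \o fst)).
pose q := if [seq r <- h | R e r.1.1] is r :: _ then Some r.2 else None.
pose b : bmove n := (e, q).
have sep_e r : r \in h -> R e r.1.1 -> sigma h b != r.2.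
  move=> rh Rer; have := legal h b; rewrite /b /q /=.
  have: r \in [seq r <- h | R e r.1.1] by rewrite mem_filter Rer.
  case E : [seq _ <- _ | _] => [//|r0 s] _.
  have: r0 \in [seq r <- h | R e r.1.1] by rewrite E mem_head.
  rewrite mem_filter => /andP[Rer0 r0h].
  have er : r0.1.1 = r.1.1.
    by apply: (oneR e) => //; apply: rank_e; exact: hes.
  (* No edge is exposed twice, so a round is determined by its edge. *)
  have -> : r0 = r.
    have uh : uniq (map (fst \o fst) h) by rewrite map_comp play_moves ebs.
    exact: (uniq_map_inj_in uh) er.
  by rewrite eq_sym.
exists (rcons bs b); first by rewrite map_rcons ebs.
move=> r r'; rewrite play_rcons !mem_rcons !inE -/h.
case/orP=> [/eqP->|rh] /orP[/eqP->|r'h] /=.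
- by rewrite irrR.
- exact: sep_e.
- by rewrite symR eq_sym => ?; exact: sep_e.
- exact: sep.
Qed.

Lemma path_index_lt T a b :
  a < T.*2 -> b < T.*2 -> path_index T.*2 a b < T.
Proof. by move=> ? ?; rewrite ltn_divLR //; case: ifP; lia. Qed.

(** [M] is separate from [n] because the board may be smaller than the K_M that is decomposed. *)
Definition edge_index (M : nat) {n : nat} (e : Kedge n) : nat :=
  edge_lift (path_index M) e.

Definition edge_rank (M : nat) {n : nat} (e : Kedge n) : nat :=
  edge_lift (path_rank M) e.

Lemma edge_indexE M n (e : Kedge n) x y :
  val e = [set x; y] -> edge_index M e = path_index M x y.
Proof. by apply: edge_liftE => i j; exact: path_indexC. Qed.

Lemma edge_rankE M n (e : Kedge n) x y :
  val e = [set x; y] -> edge_rank M e = path_rank M x y.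
Proof. by apply: edge_liftE => i j; exact: path_rankC. Qed.

(** For even M >= n, these are the pairs of consecutive edges of a zigzag path. *)
Definition path_adjacent (M : nat) {n : nat} : rel (Kedge n) := fun e e' =>
  [&& e != e', edge_index M e == edge_index M e' &
      ~~ [disjoint val e & val e']].

Lemma path_adjacent_sym M n : symmetric (@path_adjacent M n).
Proof.
by move=> e e'; rewrite /path_adjacent eq_sym [edge_index _ _ == _]eq_sym
   disjoint_sym.
Qed.

Lemma path_adjacentP T n (e e' : Kedge n) a b :
  n <= T.*2 -> path_adjacent T.*2 e e' -> val e = [set a; b] ->
  exists w, [/\ w != a, w != b &
    (val e' = [set a; w] /\ path_index T.*2 a b = path_index T.*2 a w) \/
    (val e' = [set b; w] /\ path_index T.*2 a b = path_index T.*2 b w)].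
Proof.
move=> nT /and3P[ne /eqP eidx dj] eab.
have /cards2P[x [y [xy exy]]] := valP e'.
wlog xe : x y xy exy / x \in val e.
  move=> IH; case: (boolP (x \in val e)) => [xe|xe]; first exact: (IH x y).
  apply: (IH y x); rewrite 1?eq_sym // ?exy 1?setUC //.
  apply: contraR dj => ye; rewrite exy disjoint_sym.
  apply/pred0P => z /=; rewrite !inE.
  by apply/negP => /andP[/orP[] /eqP -> H]; [case/negP: xe | case/negP: ye].
have ney : val e' <> [set a; b] by rewrite -eab => /val_inj e'e; rewrite e'e eqxx in ne.
move: eidx; rewrite (edge_indexE _ eab) (edge_indexE _ exy).
move: xe xy ney; rewrite exy eab !inE => /orP[] /eqP -> xy ney eidx; exists y.
  split; [by rewrite eq_sym| |by left].
  by apply/eqP => yb; apply: ney; rewrite yb.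
split; [|by rewrite eq_sym|by right].
by apply/eqP => ya; apply: ney; rewrite ya setUC.
Qed.

(** If [e1] and [e2] meet [e] at the same end, [path_index_next] identifies them; opposite ends are
    excluded by [path_rank_ends]. *)
Lemma path_adjacent_lower T n (e e1 e2 : Kedge n) :
  n <= T.*2 ->
  edge_rank T.*2 e1 <= edge_rank T.*2 e -> edge_rank T.*2 e2 <= edge_rank T.*2 e ->
  path_adjacent T.*2 e e1 -> path_adjacent T.*2 e e2 -> e1 = e2.
Proof.
move=> nT r1 r2 adj1 adj2.
have /cards2P[a [b [ab eab]]] := valP e.
have hT (i : 'I_n) : i < T.*2 by exact: leq_trans (ltn_ord i) nT.
have [w [wa wb hw]] := path_adjacentP nT adj1 eab.
have [x [xa xb hx]] := path_adjacentP nT adj2 eab.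
rewrite !(edge_rankE _ eab) in r1 r2.
case: hw => -[ew iw]; case: hx => -[ex ix];
  rewrite (edge_rankE _ ew) in r1; rewrite (edge_rankE _ ex) in r2.
- apply: val_inj; rewrite ew ex; congr [set _; _]; apply: val_inj.
  have wE := path_index_next (hT a) (hT b) (hT w) wb iw.
  exact: etrans wE (esym (path_index_next (hT a) (hT b) (hT x) xb ix)).
- by case: (@path_rank_ends T a b w x).
- by case: (@path_rank_ends T a b x w).
apply: val_inj; rewrite ew ex; congr [set _; _]; apply: val_inj.
rewrite path_indexC in iw ix.
have wE := path_index_next (hT b) (hT a) (hT w) wa iw.
exact: etrans wE (esym (path_index_next (hT b) (hT a) (hT x) xa ix)).
Qed.

Lemma builder_wins t n : 3 <= t -> n <= 2 * t - 2 -> ~ painter_wins (star t) n.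
Proof.
move=> ht nt [sigma [legal win]].
pose T := t.-1; have nT : n <= T.*2 by rewrite /T; lia.
(* Sorting by rank interleaves the paths, but keeps the edges of each path in order. *)
pose leR : rel (Kedge n) := relpre (edge_rank T.*2) leq.
have leRT : transitive leR by move=> x y z; exact: leq_trans.
pose es := sort leR (enum {: Kedge n}).
have [] := @builder_separates n sigma (path_adjacent T.*2) (edge_rank T.*2) es.
- exact: legal.
- exact: path_adjacent_sym.
- by move=> e; rewrite /path_adjacent eqxx.
- by move=> e e1 e2; exact: path_adjacent_lower.
- by rewrite sort_uniq enum_uniq.
- rewrite -(sorted_pairwise leRT); apply: sort_sorted => x y; exact: leq_total.
move=> bs ebs sep.
have fbs : full_bmoves bs.
  by split=> [|e]; rewrite ebs ?sort_uniq ?enum_uniq // mem_sort mem_enum.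
have [k [phi [phi_inj [c mono]]]] := win bs fbs.
have leafP i : exists2 r, r \in play sigma bs &
    val r.1.1 = [set phi None; phi (Some i)] /\ r.2 = c.
  have [e ee] : exists e : Kedge n, val e = [set phi None; phi (Some i)].
    by apply: exists_Kedge; apply/eqP => /phi_inj.
  have [|r rh [re rc]] := mono e; first by apply/mem_star_copy; exists i.
  by exists r; [exact: sub_play_take rh | rewrite re].
have hT (v : 'I_n) : v < T.*2 by exact: leq_trans (ltn_ord v) nT.
(* Two edges of the star on one path would be adjacent there, hence differently colored; so t edges
   need t paths, and there are only t - 1. *)
pose idx (i : 'I_t) : 'I_T :=
  Ordinal (path_index_lt (hT (phi None)) (hT (phi (Some i)))).
have idx_inj : injective idx.
  move=> i j /(congr1 val) /= ij; apply/eqP/negP => /negP nij.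
  have [r rh [re rc]] := leafP i; have [r' r'h [r'e r'c]] := leafP j.
  suff /(sep r r' rh r'h) : path_adjacent T.*2 r.1.1 r'.1.1 by rewrite rc r'c eqxx.
  rewrite /path_adjacent (edge_indexE _ re) (edge_indexE _ r'e) ij eqxx /=.
  apply/andP; split.
    apply/eqP => err; have: phi (Some i) \in val r'.1.1.
      by rewrite -err re !inE eqxx orbT.
    rewrite r'e !inE => /orP[] /eqP /phi_inj //.
    by case=> eij; rewrite eij eqxx in nij.
  apply/pred0Pn; exists (phi None).
  by rewrite /= re r'e !inE eqxx.
by have := leq_card idx idx_inj; rewrite !card_ord /T; lia.
Qed.

Lemma play_memoryless (n : nat) (s : bmove n -> color) bs :
  play (fun=> s) bs = [seq (b, s b) | b <- bs].
Proof.
by elim/last_ind: bs => // bs b IH; rewrite play_rcons map_rcons IH.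
Qed.

Lemma painter_wins_double t : 0 < t -> painter_wins (star t) (2 * t).
Proof.
move=> ht; pose red : color := ord0; pose blue : color := ord_max.
pose s (b : bmove (2 * t)) := if b.2 == Some red then blue else red.
exists (fun=> s); split=> [h b|bs [_ full]].
  by rewrite /s; case: (b.2 =P Some red) => [->|/eqP].
exists (size bs); rewrite take_size play_memoryless.
have n0 : 0 < 2 * t by lia.
(* Any vertex would do: its 2t - 1 edges receive only two colors. *)
pose v := Ordinal n0.
pose A c := [set u in [set~ v] |
  has (fun b => (val b.1 == [set v; u]) && (s b == c)) bs].
have cov : [set~ v] \subset A red :|: A blue.
  apply/subsetP => u uv; rewrite !inE in uv *.
  have [|e eu] := @exists_Kedge _ v u; first by rewrite eq_sym.
  have /mapP[b bbs be] := full e.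
  have hb c : s b = c ->
      has (fun b => (val b.1 == [set v; u]) && (s b == c)) bs.
    by move=> sb; apply/hasP; exists b => //; rewrite -be eu sb !eqxx.
  rewrite uv /=; have : s b = red \/ s b = blue by rewrite /s; case: ifP; [right|left].
  by case=> /hb ->; rewrite ?orbT.
have [c tA] : exists c, t <= #|A c|.
  have := subset_leq_card cov; rewrite cardsC1 card_ord => cv.
  have := leq_trans cv (leq_card_setU (A red) (A blue)).
  by case: (leqP t #|A red|) => [?|h1 h2]; [exists red | exists blue; lia].
have vA : v \notin A c by rewrite !inE eqxx.
have [phi [phi_inj phi0 phiA]] := star_embedding vA tA.
exists phi; split=> //; exists c => e /mem_star_copy[i ei].
have := phiA i; rewrite !inE => /andP[_ /hasP[b bbs /andP[/eqP be /eqP sb]]].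
exists (b, s b); first by apply/mapP; exists b.
by split=> //=; apply: val_inj; rewrite be ei phi0.
Qed.

(** * Colorings in which every color has large degree *)

Definition degree (f : nat -> nat -> nat) (c i : nat) (s : seq nat) : nat :=
  count (fun j => (j != i) && (f i j == c)) s.

(** Colorings are functions on [nat], so that small cases are settled by evaluation and boards can
    be enlarged without casts. *)
Definition balanced (f : nat -> nat -> nat) (n d : nat) : Prop :=
  [/\ forall i j, f i j = f j i, forall i j, f i j < 3 &
      forall c i, c < 3 -> i < n -> d <= degree f c i (iota 0 n)].

Lemma count_shift_mod3 d k c :
  c < 3 -> count (fun j => (j + k) %% 3 == c) (iota 0 (3 * d)) = d.
Proof.
move=> c3; elim: d => // d IH; rewrite mulnS addnC iotaD count_cat IH /=.
have : c = 0 \/ c = 1 \/ c = 2 by lia.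
by case=> [->|[->|->]]; lia.
Qed.

(* Six vertices n, ..., n+5 are added. Each old vertex receives two edges of
   each color. A new vertex n+k receives at least d edges of each color from the
   old vertices, and at least d + 1 of color k mod 3; the zigzag paths of K_6
   give it two edges of the other colors and one of color k mod 3. *)
Definition extend (f : nat -> nat -> nat) (n i j : nat) : nat :=
  if (i < n) && (j < n) then f i j
  else if (n <= i) && (n <= j) then ((i - n + (j - n)) %% 6) %/ 2
  else (i + j - n) %% 3.

Lemma balanced_extend f n d e :
  n = 3 * d + e -> 0 < e -> balanced f n d ->
  balanced (extend f n) (n + 6) (d + 2).
Proof.
move=> en e0 [fC f3 fd]; split=> [i j|i j|c i c3 i6].
- by rewrite /extend andbC fC [(n <= i) && _]andbC addnC [i + j]addnC.
- by rewrite /extend; do 2!case: ifP => _ //; lia.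
have -> : iota 0 (n + 6) = iota 0 n ++ map (addn n) (iota 0 6).
  by rewrite iotaD -iotaDl addn0.
rewrite /degree count_cat count_map.
case: (ltnP i n) => [lt_in|le_ni].
  apply: leq_add.
    apply: leq_trans (fd c i c3 lt_in) _; apply: eq_leq; apply: eq_in_count => j.
    by rewrite mem_iota /extend lt_in => /= ->.
  rewrite (@eq_count _ _ (fun k => (k + i) %% 3 == c)) ?(@count_shift_mod3 2) //.
  move=> k /=; rewrite /extend lt_in ltnNge leq_addr /= leqNgt lt_in /=.
  have -> : n + k != i by lia.
  by have -> : i + (n + k) - n = k + i by lia.
have [k ek] : exists k, i = n + k by exists (i - n); lia.
have k6 : k < 6 by lia.
rewrite {i le_ni i6}ek.
have -> : count (fun j => (j != n + k) && (extend f n (n + k) j == c)) (iota 0 n) =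
    count (fun j => (j + k) %% 3 == c) (iota 0 n).
  apply: eq_in_count => j; rewrite mem_iota /= add0n => jn; rewrite /extend.
  have -> : j != n + k by lia.
  by rewrite [j < n]jn ltnNge leq_addr /= [n <= j]leqNgt jn /= -addnA addKn addnC.
(* The surplus edge goes to the old vertex 3d, which exists because e > 0. *)
have outer : d + (k %% 3 == c) <= count (fun j => (j + k) %% 3 == c) (iota 0 n).
  have -> : n = 3 * d + 1 + e.-1 by lia.
  rewrite 2!iotaD 2!count_cat count_shift_mod3 //= -addnA leq_add2l.
  by rewrite addn0 add0n mulnC modnMDl leq_addr.
have inner : 2 <= (k %% 3 == c) +
    count (fun j => (j != k) && (((k + j) %% 6) %/ 2 == c)) (iota 0 6).
  have : all (fun k => all (fun c => 2 <= (k %% 3 == c) +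
      count (fun j => (j != k) && (((k + j) %% 6) %/ 2 == c)) (iota 0 6))
      (iota 0 3)) (iota 0 6) by [].
  by move/allP/(_ k); rewrite mem_iota => /(_ k6) /allP/(_ c); rewrite mem_iota; apply.
rewrite (@eq_count _ (preim _ _) (fun j => (j != k) && (((k + j) %% 6) %/ 2 == c))).
  by lia.
by move=> j /=; rewrite /extend eqn_add2l !ltnNge !leq_addr /= !addKn.
Qed.

(* The three perfect matchings of K_4. *)
Definition K4_color (i j : nat) : nat :=
  if (i + j == 1) || (i + j == 5) then 0
  else if odd (i + j) then 1 else 2.

(* The cycle 01234 alternates 0, 1, 0, 1, 0; the chord 02 has color 1, because
   vertex 0 lies on two edges of color 0, and the other chords have color 2. *)
Definition K5_color (i j : nat) : nat :=
  if (i + j, maxn i j) \in [:: (1, 1); (5, 3); (4, 4)] then 0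
  else if (i + j, maxn i j) \in [:: (3, 2); (7, 4); (2, 2)] then 1 else 2.

(** Induction in steps of two, from d = 0, where nothing is required, and d = 1, where the board is
    K_4 or K_5. *)
Lemma exists_balanced d e : 0 < e <= 2 -> exists f, balanced f (3 * d + e) d.
Proof.
move=> he; elim/ltn_ind: d => -[|[|d]] IH.
- by exists (fun _ _ => 0); split.
- have /orP[/eqP->|/eqP->] : (e == 1) || (e == 2) by lia.
    exists K4_color; split=> [i j|i j|c i c3 i4].
    + by rewrite /K4_color addnC.
    + by rewrite /K4_color; do 2?[case: ifP => _ //].
    have : all (fun i => all (fun c => 0 < degree K4_color c i (iota 0 4))
      (iota 0 3)) (iota 0 4) by [].
    by move/allP/(_ i); rewrite mem_iota => /(_ i4) /allP/(_ c); rewrite mem_iota; apply.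
  exists K5_color; split=> [i j|i j|c i c3 i5].
  + by rewrite /K5_color addnC maxnC.
  + by rewrite /K5_color; do 2?[case: ifP => _ //].
  have : all (fun i => all (fun c => 0 < degree K5_color c i (iota 0 5))
    (iota 0 3)) (iota 0 5) by [].
  by move/allP/(_ i); rewrite mem_iota => /(_ i5) /allP/(_ c); rewrite mem_iota; apply.
have [|f bf] := IH d; first by lia.
exists (extend f (3 * d + e)).
have -> : 3 * d.+2 + e = 3 * d + e + 6 by lia.
by rewrite -(addn2 d); apply: (@balanced_extend f _ d e) => //; lia.
Qed.

(** * Bounds for xi of a star *)

Lemma degreeE n (f : nat -> nat -> nat) c (v : 'I_n) :
  degree f c v (iota 0 n) = #|[set u : 'I_n | (u != v) && (f v u == c)]|.
Proof.
rewrite cardsE cardE size_filter /degree -val_enum_ord count_map enumT.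
exact: eq_count.
Qed.

(** A star missing color [c] has its leaves among the at most n - 1 - d < t vertices joined to the
    centre in other colors. *)
Lemma xi_admissible_balanced t n d f :
  0 < t -> n <= d + t -> balanced f n d -> xi_admissible (star t) n.
Proof.
move=> t0 nt [fC f3 fd].
pose g i j : color := inord (f i j).
have gC i j : g i j = g j i by rewrite /g fC.
exists [ffun e => edge_lift g e] => phi phi_inj c.
pose v := phi None.
pose N := [set u | (u != v) && (f v u == c)].
case: (pickP (fun i : 'I_t => phi (Some i) \in N)) => [i|none].
  rewrite inE => /andP[iv /eqP fc].
  have [|e ee] := @exists_Kedge _ v (phi (Some i)); first by rewrite eq_sym.
  exists e; first by apply/mem_star_copy; exists i.
  by rewrite ffunE (edge_liftE gC ee) /g fc inord_val.
exfalso; have leaves i : phi (Some i) \in [set~ v] :\: N.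
  by rewrite in_setD none !inE; apply/eqP => /phi_inj.
have := card_star_leaves phi_inj leaves.
have := fd c v (ltn_ord c) (ltn_ord v); rewrite degreeE -/N => dN.
have NV : N \subset [set~ v] by apply/subsetP => u; rewrite !inE => /andP[].
have := subset_leq_card NV.
rewrite cardsD (setIidPr NV) cardsC1 card_ord.
have := leq_ltn_trans (leq0n v) (ltn_ord v).
by move: #|N| dN => k; lia.
Qed.

(** One vertex suffices: t of its edges avoiding a color would form a forbidden star, so each color
    occurs there at least n - t times. *)
Lemma xi_admissible_le t n :
  3 <= t -> xi_admissible (star t) n -> 2 * n <= 3 * t - 1.
Proof.
move=> ht [col col3]; case: n col col3 => [|n] col col3; first by lia.
pose v : 'I_n.+1 := ord0.
pose N c := [set u in [set~ v] | [exists e, (val e == [set v; u]) && (col e == c)]].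
have co_N c : #|[set~ v] :\: N c| < t.
  rewrite ltnNge; apply/negP => tN.
  have vN : v \notin [set~ v] :\: N c by rewrite !inE eqxx andbF.
  have [phi [phi_inj phi0 phiN]] := star_embedding vN tN.
  have [e eC ec] := col3 phi phi_inj c; have [i ei] := mem_star_copy phi e eC.
  have := phiN i; rewrite !inE => /andP[/negP nN uv]; apply: nN.
  by rewrite uv; apply/existsP; exists e; rewrite ei ec phi0 !eqxx.
have NV c : N c \subset [set~ v] by apply/subsetP => u; rewrite inE => /andP[].
have disjN c c' : c != c' -> [disjoint N c & N c'].
  move=> cc; apply/pred0P => u /=; apply/negP; rewrite !inE.
  case/andP=> /andP[_ /existsP[e /andP[/eqP ee /eqP ec]]].
  case/andP=> _ /existsP[e' /andP[/eqP e'e /eqP e'c]].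
  by case/eqP: cc; rewrite -ec -e'c; congr (col _); apply: val_inj; rewrite ee.
(* Double counting: each vertex other than [v] lies in at most one [N c]. *)
have sumN : \sum_c #|N c| <= n.
  have -> : \sum_c #|N c| = \sum_c \sum_(u in [set~ v]) (u \in N c).
    apply: eq_bigr => c _; rewrite -sum1_card big_mkcond [RHS]big_mkcond /=.
    apply: eq_bigr => u _; case: (boolP (u \in N c)) => [uN|]; last by case: ifP.
    by rewrite (subsetP (NV c) _ uN).
  rewrite exchange_big /=.
  apply: (@leq_trans (\sum_(u in [set~ v]) 1)); last by rewrite sum1_card cardsC1 card_ord.
  apply: leq_sum => u _.
  case: (pickP (fun c => u \in N c)) => [c uc|none].
    rewrite (bigD1 c) //= uc big1 // => c' c'c; apply/eqP; rewrite eqb0.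
    by rewrite (disjointFr (disjN c c' _) uc) // eq_sym.
  by rewrite big1 // => c _; rewrite none.
have le_t c : n.+1 <= #|N c| + t.
  have := co_N c; have := subset_leq_card (NV c).
  by rewrite cardsD (setIidPr (NV c)) cardsC1 card_ord /=; lia.
have : \sum_(c : color) n.+1 <= \sum_(c : color) (#|N c| + t) by apply: leq_sum.
rewrite big_split /= !sum_nat_const card_ord => /leq_trans/(_ (leq_add sumN (leqnn _))).
by lia.
Qed.

Theorem proposition1p3 (t : nat) (ht : 3 <= t) :
  is_xi (star t) ((3 * t - 1) %/ 2) /\
  exists m : nat, is_f (star t) m /\ 2 * t - 1 <= m <= 2 * t.
Proof.
split.
  split=> [|m /(xi_admissible_le ht)]; last by rewrite leq_divRL // mulnC.
  (* This [e] makes t - e even and keeps e positive; then n = 3d + e equals d + t. *)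
  pose e := if odd t then 1 else 2.
  have [d td] : exists d, t = 2 * d + e.
    exists ((t - e) %/ 2); rewrite /e; case: ifP; lia.
  have he : 0 < e <= 2 by rewrite /e; case: ifP.
  have -> : (3 * t - 1) %/ 2 = 3 * d + e by lia.
  have [f bf] := exists_balanced d he.
  by apply: (xi_admissible_balanced _ _ bf); lia.
have win2t : painter_wins (star t) (2 * t) by apply: painter_wins_double; lia.
have lower m : painter_wins (star t) m -> 2 * t - 1 <= m.
  by move=> wm; rewrite leqNgt; apply/negP => mt; apply: (builder_wins ht _ wm); lia.
(* The winner on 2t - 1 vertices is left open; f is 2t - 1 or 2t accordingly. *)
have [win|lose] := classic (painter_wins (star t) (2 * t - 1)).
  by exists (2 * t - 1); split; [split | lia].
exists (2 * t); split; [split=> // m wm | lia].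
have := lower m wm; rewrite leq_eqVlt => /orP[/eqP em|]; last by lia.
by case: lose; rewrite em.
Qed.
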